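(* Let $n\ge1$, let $m\in\mathbb{R}$, let $k,\ell$ be integers $\ge1$, and let $g=g^{(k,\ell)}$. Then $$\Sigma_{k,\ell}^m=S\big(\lambda_g^{m\left(\frac{k\ell}{k+\ell}\right)},g\big).$$
   Context: $\Sigma_{k,\ell}^m$ is the set of all $a\in C^\infty(\mathbb{R}^n\times\mathbb{R}^n)$ such that for all multi-indices $\alpha,\beta$ there is $C_{\alpha\beta}>0$ with $|\partial_x^\beta\partial_\xi^\alpha a(x,\xi)|\le C_{\alpha\beta}(1+|x|^k+|\xi|^\ell)^{m-\frac{|\beta|}{k}-\frac{|\alpha|}{\ell}}$ for all $x,\xi\in\mathbb{R}^n$. The metric $g^{(k,\ell)}$ on $\mathbb{R}^n\times\mathbb{R}^n$ is, at $X=(x,\xi)$, $$g_X=\frac{dx^2}{(1+|x|^{2k}+|\xi|^{2\ell})^{1/k}}+\frac{d\xi^2}{(1+|x|^{2k}+|\xi|^{2\ell})^{1/\ell}},$$ with uncertainty parameter $\lambda_g(x,\xi)=(1+|x|^{2k}+|\xi|^{2\ell})^{\frac{k+\ell}{2k\ell}}$. For a positive function $M$ on $\mathbb{R}^n\times\mathbb{R}^n$, $S(M,g)$ is the set of smooth functions $a$ on $\mathbb{R}^n\times\mathbb{R}^n$ such that for every integer $j\ge0$ there is $C_j>0$ with $|a^{(j)}(X;T_1,\dots,T_j)|\le C_jM(X)\prod_{i=1}^j g_X(T_i)^{1/2}$ for all $X,T_1,\dots,T_j\in\mathbb{R}^n\times\mathbb{R}^n$, where $a^{(j)}(X;T_1,\dots,T_j)$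 is the $j$-th derivative of $a$ at $X$ in the directions $T_1,\dots,T_j$. *)

(* Defs.v *)
From HB Require Import structures.
From mathcomp Require Import all_boot all_order all_algebra.
From mathcomp Require Import all_classical all_reals all_analysis.
From mathcomp Require Export complex.

Set Implicit Arguments.
Unset Strict Implicit.
Unset Printing Implicit Defensive.

Import Order.TTheory GRing.Theory Num.Theory.
Import numFieldNormedType.Exports.

Local Open Scope classical_set_scope.
Local Open Scope ring_scope.

(* [Rcomplex R] is the complex plane R[i] seen as a real vector space, which
   already carries the modulus as its R-valued norm.  Equipping it with the
   topology of that norm makes the library's directional derivative ['D_v a]
   available for complex-valued functions of real variables. *)
Section Rcomplex_normedModType.
Context (R : realType).

HB.instance Definition _ :=
  PseudoMetric.copy (Rcomplex R) (pseudoMetric_normed (Rcomplex R)).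
HB.instance Definition _ := isPointed.Build (Rcomplex R) 0.
HB.instance Definition _ :=
  NormedZmod_PseudoMetric_eq.Build R (Rcomplex R) erefl.

Lemma Rcomplex_normrZ (t : R) (z : Rcomplex R) : `|t *: z| = `|t| * `|z|.
Proof.
case: z => a b.
have -> : t *: (Complex a b : Rcomplex R) = Complex (t * a) (t * b) by [].
rewrite /Num.norm /= !exprMn -mulrDr sqrtrM ?sqr_ge0//.
by rewrite sqrtr_sqr.
Qed.

HB.instance Definition _ :=
  PseudoMetricNormedZmod_Lmodule_isNormedModule.Build R (Rcomplex R)
    Rcomplex_normrZ.
End Rcomplex_normedModType.

Notation phase_space R n := ('rV[R]_n * 'rV[R]_n)%type.

Section Symbols.
Context {R : realType} {n : nat}.
Local Notation V := (phase_space R n).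

(* The library norm on ['rV[R]_n] is the maximum norm. *)
Definition euclidean_norm (x : 'rV[R]_n) : R := Num.sqrt (\sum_i x 0 i ^+ 2).

Definition dir_x (i : 'I_n) : V := (delta_mx 0 i, 0).
Definition dir_xi (i : 'I_n) : V := (0, delta_mx 0 i).
Definition dir (s : 'I_n + 'I_n) : V :=
  match s with inl i => dir_x i | inr i => dir_xi i end.

(* [iter_derive [:: T1; ...; Tj] a X] is a^(j)(X; T1, ..., Tj), computed as
   D_T1 (... (D_Tj a)) at X. *)
Definition iter_derive (T : seq V) (a : V -> Rcomplex R) : V -> Rcomplex R :=
  foldr (fun v b => 'D_v b) a T.

(* C^infty: all partial derivatives of all orders exist and are continuous. *)
Definition smooth (a : V -> Rcomplex R) : Prop :=
  forall s : seq ('I_n + 'I_n),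
    continuous (iter_derive (map dir s) a) /\
    forall (i : 'I_n + 'I_n) (X : V),
      derivable (iter_derive (map dir s) a) X (dir i).

Definition mi_order (alpha : {ffun 'I_n -> nat}) : nat := (\sum_i alpha i)%N.

Definition mi_dirs (e : 'I_n -> V) (alpha : {ffun 'I_n -> nat}) : seq V :=
  flatten [seq nseq (alpha i) (e i) | i <- enum 'I_n].

Definition partial_x_xi (beta alpha : {ffun 'I_n -> nat}) :
    (V -> Rcomplex R) -> V -> Rcomplex R :=
  iter_derive (mi_dirs dir_x beta ++ mi_dirs dir_xi alpha).

Definition Sigma_class (m : R) (k l : nat) : set (V -> Rcomplex R) :=
  [set a | smooth a /\
    forall alpha beta : {ffun 'I_n -> nat}, exists2 C : R, 0 < C &
      forall x xi : 'rV[R]_n,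
        `|partial_x_xi beta alpha a (x, xi)| <=
        C * (1 + euclidean_norm x ^+ k + euclidean_norm xi ^+ l) `^
          (m - (mi_order beta)%:R / k%:R - (mi_order alpha)%:R / l%:R)].

Definition weight (k l : nat) (X : V) : R :=
  1 + euclidean_norm X.1 ^+ (2 * k) + euclidean_norm X.2 ^+ (2 * l).

(* [metric k l X T] is the value g_X(T) of the quadratic form g_X. *)
Definition metric (k l : nat) (X T : V) : R :=
  euclidean_norm T.1 ^+ 2 / weight k l X `^ (k%:R^-1) +
  euclidean_norm T.2 ^+ 2 / weight k l X `^ (l%:R^-1).

Definition uncertainty (k l : nat) (X : V) : R :=
  weight k l X `^ ((k + l)%:R / (2 * k * l)%:R).

Definition S_class (M : V -> R) (g : V -> V -> R) : set (V -> Rcomplex R) :=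
  [set a | smooth a /\
    forall j : nat, exists2 C : R, 0 < C &
      forall (X : V) (T : j.-tuple V),
        `|iter_derive T a X| <=
        C * M X * \prod_(i < j) Num.sqrt (g X (tnth T i))].

End Symbols.

(* Main.v *)
Require Import Defs.
From mathcomp Require Import all_boot all_order all_algebra.
From mathcomp Require Import all_classical all_reals all_analysis.
From mathcomp Require Import ring lra.

Import Order.TTheory GRing.Theory Num.Theory.
Import numFieldNormedType.Exports.

Local Open Scope classical_set_scope.
Local Open Scope ring_scope.

(** Put W = [weight k l].  Two facts make the classes coincide.

    On the level of weights, W and the square of Q = 1 + |x|^k + |xi|^l are
    comparable up to the factor 3 ([weight_comparable]), so that Q^p and
    W^(p/2) are comparable for every real exponent p, of either sign
    ([weight_powR_comparable]).  The S-class weight is W^(m/2)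
    ([uncertainty_powE]), and each derivative in x (resp. xi) improves a bound
    by W^(-1/(2k)) (resp. W^(-1/(2l))), which is the g_X-length of a coordinate
    vector ([sqrt_metric_dir]).  Both definitions thus prescribe the same
    weights, if only they spoke of the same derivatives.

    They do not: one bounds the mixed partials with the x-derivatives written
    first, the other bounds derivatives in arbitrary directions.  The bridge is
    [coordinate_bounds], which bounds the derivatives along all words in the
    2n coordinate directions.  Words reduce to multi-indices since partial
    derivatives commute ([partial_perm]).  Arbitrary directions reduce to words
    since a derivative in direction v is the combination of the partial
    derivatives with the coordinates of v as coefficients
    ([smooth_directional_derivative]); by iteration a j-th derivative is
    j-linear in its directions ([iter_derive_bound]), and each coordinate of v
    times the g_X-length of its direction is at most g_X(v)^(1/2)
    ([coord_dual_length_le]).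

    Smoothness is given here by continuous partial derivatives, not by Frechet
    differentiability, so both calculus facts (linearity in the direction and
    symmetry of second derivatives) are derived from the one-dimensional mean
    value theorem, for real-valued functions and then for the real and
    imaginary parts of a complex-valued one. *)

(** * Directional derivatives of real-valued functions *)

Lemma is_derive_of_cvg {R : realType} {E W : normedModType R} (f : E -> W) (X v : E) (d : W) :
  h^-1 *: (f (h *: v + X) - f X) @[h --> 0^'] --> d -> is_derive X v f d.
Proof.
move=> fd; apply: DeriveDef; first by apply: cvgP fd.
exact: cvg_lim fd.
Qed.

Lemma cvg_of_is_derive {R : realType} {E W : normedModType R} (f : E -> W) (X v : E) (d : W) :
  is_derive X v f d -> h^-1 *: (f (h *: v + X) - f X) @[h --> 0^'] --> d.
Proof. by case=> fd <-; exact: fd. Qed.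

Section RealValued.
Context {R : realType} {E : normedModType R}.
Implicit Types (f g h : E -> R) (u v X : E).

Lemma is_derive_line f X v t (d : R) :
  is_derive (X + t *: v) v f d ->
  is_derive t (1 : R) (fun s : R => f (X + s *: v)) d.
Proof.
move=> /cvg_of_is_derive fd.
apply: is_derive_of_cvg.
suff -> : (fun h : R => h^-1 *: (f (X + (h *: 1 + t) *: v) - f (X + t *: v))) =
  (fun h : R => h^-1 *: (f (h *: v + (X + t *: v)) - f (X + t *: v))) by [].
apply/funext => s.
by rewrite scalerDl /GRing.scale /= mulr1 addrCA.
Qed.

(** The mean value theorem on the line X + s v.  The intermediate point is only
    located by its size, which treats both signs of t at once and is all that
    the limits below use. *)
Lemma directional_mean_value f g v :
  (forall X, is_derive X v f (g X)) ->
  forall X t, exists2 c : R, `|c| <= `|t| &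
    f (X + t *: v) - f X = t * g (X + c *: v).
Proof.
move=> fg.
have pos X t : 0 <= t -> exists2 c : R, 0 <= c <= t &
    f (X + t *: v) - f X = t * g (X + c *: v).
  move=> t0.
  have dl s : is_derive s (1 : R) (fun s : R => f (X + s *: v)) (g (X + s *: v)).
    exact: is_derive_line.
  have cl : {within `[0, t], continuous (fun s : R => f (X + s *: v))}.
    by apply: derivable_within_continuous => s _; case: (dl s).
  have [c] := @MVT_segment R _ _ 0 t t0 (fun s _ => dl s) cl.
  rewrite in_itv/= => c0t; rewrite scale0r addr0 subr0 mulrC => ->.
  by exists c.
move=> X t; have [t0|t0] := leP 0 t.
  have [c /andP[c0 ct] fc] := pos X t t0.
  by exists c => //; rewrite !ger0_norm.
have [|c /andP[c0 ct]] := pos (X + t *: v) (- t); first by rewrite oppr_ge0 ltW.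
rewrite scaleNr addrK -addrA -scalerDl => fc.
exists (t + c); last by rewrite -opprB fc mulNr opprK.
by rewrite !ler0_norm //; lra.
Qed.

(** Mean value arguments in two directions end at unspecified points of a small
    parallelogram at X; this is the form in which continuity controls them. *)
Lemma continuous_parallelogram g X u v (e : R) : 0 < e -> continuous g ->
  exists2 d : R, 0 < d & forall s t, `|s| <= d -> `|t| <= d ->
    `|g (X + s *: u + t *: v) - g X| < e.
Proof.
move=> e0 /(_ X) /cvgrPdist_lt /(_ e e0) /nbhs_normP[d /= d0 Hd].
pose M := `|u| + `|v| + 1.
have M0 : 0 < M by rewrite ltr_wpDl // addr_ge0.
exists (d / 2 / M); first by rewrite !divr_gt0.
move=> s t sd td; rewrite distrC; apply: Hd => /=.
rewrite -addrA opprD addNKr normrN.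
apply: (@le_lt_trans _ _ (d / 2)); last by lra.
apply: (le_trans (ler_normD _ _)); rewrite !normrZ.
have : (d / 2 / M) * (`|u| + `|v|) <= d / 2.
  by rewrite mulrAC ler_pdivrMr // ler_wpM2l //; [lra|rewrite /M; lra].
apply: le_trans; rewrite mulrDr.
by apply: lerD; apply: ler_wpM2r.
Qed.

(** The increment along t (u + v) is an increment along t u, followed by one
    along t v started at X + t u.  By the mean value theorem the second one is
    t times a value of the v-derivative near X, so continuity of that
    derivative is what replaces Frechet differentiability. *)
Lemma is_deriveD_dir f g h u v :
  (forall X, is_derive X u f (g X)) -> (forall X, is_derive X v f (h X)) ->
  continuous h -> forall X, is_derive X (u + v) f (g X + h X).
Proof.
move=> fg fh ch X; apply: is_derive_of_cvg.
have -> : (fun t => t^-1 *: (f (t *: (u + v) + X) - f X)) =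
  (fun t => t^-1 *: (f (t *: u + X) - f X)) +
  (fun t => t^-1 *: (f ((t *: u + X) + t *: v) - f (t *: u + X))).
  apply/funext => t; rewrite /= !fctE -scalerDr [t *: (u + v)]scalerDr.
  congr (_ *: _); rewrite [RHS]addrC addrA addrNK.
  by congr (f _ - _); rewrite addrAC.
apply: cvgD; first exact: cvg_of_is_derive.
apply/cvgrPdist_lt => e e0.
have [d d0 Hd] := @continuous_parallelogram h X u v e e0 ch.
near=> t.
have t0 : t != 0 by near: t; exact: nbhs_dnbhs_neq.
have [c ct ->] := directional_mean_value _ _ _ fh (t *: u + X) t.
rewrite /GRing.scale /= mulKf // distrC (addrC (t *: u)); apply: Hd; last apply: (le_trans ct).
all: by near: t; apply: dnbhs0_le.
Unshelve. all: by end_near. Qed.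

(** Using the mean value theorem rather than a change of variable in the limit
    avoids setting c = 0 apart. *)
Lemma is_deriveZ_dir f g v (c : R) :
  (forall X, is_derive X v f (g X)) -> continuous g ->
  forall X, is_derive X (c *: v) f (c * g X).
Proof.
move=> fg cg X; apply: is_derive_of_cvg.
have -> : (fun t => t^-1 *: (f (t *: (c *: v) + X) - f X)) =
  (fun t => t^-1 *: (f (X + (t * c) *: v) - f X)).
  by apply/funext => t; rewrite scalerA (addrC _ X).
apply/cvgrPdist_lt => e e0.
have c0 : 0 < `|c| + 1 by rewrite ltr_wpDl.
have e'0 : 0 < e / (`|c| + 1) by rewrite divr_gt0.
have [d d0 Hd] := @continuous_parallelogram g X v 0 _ e'0 cg.
near=> t.
have t0 : t != 0 by near: t; exact: nbhs_dnbhs_neq.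
have [s st ->] := directional_mean_value _ _ _ fg X (t * c).
rewrite /GRing.scale /= mulrA mulrA mulVf // mul1r -mulrBr normrM distrC.
have sd : `|s| <= d.
  apply: (le_trans st); rewrite normrM.
  apply: (@le_trans _ _ (`|t| * (`|c| + 1))); first by rewrite ler_wpM2l // lerDl.
  rewrite -ler_pdivlMr //; near: t; apply: dnbhs0_le.
  by rewrite divr_gt0.
have := Hd s 0 sd; rewrite normr0 scale0r addr0 => /(_ (ltW d0)).
rewrite ltr_pdivlMr // => H; apply: le_lt_trans H.
by rewrite mulrC ler_wpM2l // lerDl.
Unshelve. all: by end_near. Qed.

(** Schwarz: the second difference over the parallelogram with sides t u and
    t v is symmetric in u and v; two applications of the mean value theorem, in
    either order, write it as t^2 times a value near X of one or the other
    mixed derivative. *)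
Lemma mixed_derivatives_eq f fu fv fuv fvu u v :
  (forall X, is_derive X u f (fu X)) -> (forall X, is_derive X v f (fv X)) ->
  (forall X, is_derive X v fu (fuv X)) -> (forall X, is_derive X u fv (fvu X)) ->
  continuous fuv -> continuous fvu -> fuv = fvu.
Proof.
move=> hu hv huv hvu cuv cvu; apply/funext => X.
have key (a b : E) fa fab : (forall X, is_derive X a f (fa X)) ->
    (forall X, is_derive X b fa (fab X)) -> forall t, exists s1 s2,
    [/\ `|s1| <= `|t|, `|s2| <= `|t| &
    f (X + t *: a + t *: b) - f (X + t *: a) - (f (X + t *: b) - f X) =
    t * (t * fab (X + s1 *: a + s2 *: b))].
  move=> ha hab t.
  have hd Y : is_derive Y a (fun Y => f (Y + t *: b) - f Y)
      (fa (Y + t *: b) - fa Y).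
    apply: is_deriveB; apply: is_derive_of_cvg.
    have := cvg_of_is_derive _ _ _ _ (ha (Y + t *: b)).
    by under eq_fun do rewrite addrA.
  have [s1 s1t e1] := directional_mean_value _ _ _ hd X t.
  have [s2 s2t e2] := directional_mean_value _ _ _ hab (X + s1 *: a) t.
  exists s1, s2; split=> //.
  by rewrite -e2 -e1 /=; ring.
apply/eqP; rewrite -subr_eq0 -normr_le0; apply/ler_addgt0Pr => e e0.
have e20 : 0 < e / 2 by rewrite divr_gt0.
have [d1 d10 H1] := @continuous_parallelogram fuv X u v _ e20 cuv.
have [d2 d20 H2] := @continuous_parallelogram fvu X v u _ e20 cvu.
pose t := Num.min d1 d2.
have t0 : 0 < t by rewrite lt_min d10.
have tE : `|t| = t by rewrite gtr0_norm.
have td1 : t <= d1 by rewrite ge_min lexx.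
have td2 : t <= d2 by rewrite ge_min lexx orbT.
have [s1 [s2 [s1t s2t e1]]] := key _ _ _ _ hu huv t.
have [s3 [s4 [s3t s4t e2]]] := key _ _ _ _ hv hvu t.
rewrite tE in s1t s2t s3t s4t.
have {H1}H1 := H1 s1 s2 (le_trans s1t td1) (le_trans s2t td1).
have {H2}H2 := H2 s3 s4 (le_trans s3t td2) (le_trans s4t td2).
have mid : fuv (X + s1 *: u + s2 *: v) = fvu (X + s3 *: v + s4 *: u).
  apply: (mulfI (lt0r_neq0 t0)); apply: (mulfI (lt0r_neq0 t0)).
  rewrite -e1 -e2 (addrAC X); ring.
(* Compare both mixed derivatives at X with the common value of [mid]. *)
rewrite add0r.
rewrite -(subrK (fuv (X + s1 *: u + s2 *: v)) (fuv X)) -addrA.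
apply: (le_trans (ler_normD _ _)); rewrite distrC [e]splitr lerD //; last rewrite mid.
all: exact: ltW.
Qed.
End RealValued.

(** * Transfer to complex-valued functions *)

Section ComplexValued.
Context {R : realType}.
Local Notation C := (Rcomplex R).
Local Notation re := (fun z : C => complex.Re z : R).
Local Notation im := (fun z : C => complex.Im z : R).

Lemma normc_Re_le (z : C) : `|complex.Re z| <= `|z|.
Proof.
case: z => x y; rewrite {2}/Num.norm /=.
by rewrite -sqrtr_sqr ler_sqrt ?addr_ge0 ?sqr_ge0 // lerDl sqr_ge0.
Qed.

Lemma normc_Im_le (z : C) : `|complex.Im z| <= `|z|.
Proof.
case: z => x y; rewrite {2}/Num.norm /=.
by rewrite -sqrtr_sqr ler_sqrt ?addr_ge0 ?sqr_ge0 // lerDr sqr_ge0.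
Qed.

Lemma normc_le_ReIm (z : C) : `|z| <= `|complex.Re z| + `|complex.Im z|.
Proof.
case: z => x y; rewrite {1}/Num.norm /=.
rewrite -[leRHS]ger0_norm ?addr_ge0 // -sqrtr_sqr ler_sqrt ?sqr_ge0 //.
rewrite sqrrD !real_normK ?num_real //.
by rewrite lerD2r lerDl mulrn_wge0 // mulr_ge0.
Qed.

(** The modulus is equivalent to |Re| + |Im|, so limits, and with them
    derivatives and continuity, are computed on real and imaginary parts. *)
Lemma cvg_Re_Im (T : Type) (F : set_system T) (FF : Filter F) (f : T -> C) (d : C) :
  f @ F --> d <-> (complex.Re (f x) @[x --> F] --> complex.Re d) /\
    (complex.Im (f x) @[x --> F] --> complex.Im d).
Proof.
split=> [fd|[rd id]].
  split; apply/cvgrPdist_lt => e e0; move/cvgrPdist_lt : fd => /(_ e e0);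
    apply: filterS => x; apply: le_lt_trans; rewrite -raddfB.
  - exact: normc_Re_le.
  - exact: normc_Im_le.
apply/cvgrPdist_lt => e e0; have e20 : 0 < e / 2 by rewrite divr_gt0.
move/cvgrPdist_lt : rd => /(_ _ e20) rd; move/cvgrPdist_lt : id => /(_ _ e20).
move: rd; apply: filterS2 => x rx ix.
apply: (le_lt_trans (normc_le_ReIm _)); rewrite [e]splitr.
by apply: ltrD; rewrite raddfB.
Qed.

Lemma is_derive_Re_Im (E : normedModType R) (a : E -> C) X v (d : C) :
  is_derive X v a d <-> is_derive X v (re \o a) (complex.Re d) /\
    is_derive X v (im \o a) (complex.Im d).
Proof.
have er : (fun h : R => complex.Re (h^-1 *: (a (h *: v + X) - a X))) =
   (fun h : R => h^-1 *: ((re \o a) (h *: v + X) - (re \o a) X)).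
  by apply/funext => h; rewrite linearZ raddfB.
have ei : (fun h : R => complex.Im (h^-1 *: (a (h *: v + X) - a X))) =
   (fun h : R => h^-1 *: ((im \o a) (h *: v + X) - (im \o a) X)).
  by apply/funext => h; rewrite linearZ raddfB.
split=> [/cvg_of_is_derive/cvg_Re_Im[]|[/cvg_of_is_derive rd /cvg_of_is_derive id]].
  by rewrite er ei => rd id; split; exact: is_derive_of_cvg.
by apply: is_derive_of_cvg; apply/cvg_Re_Im; rewrite er ei.
Qed.

Lemma continuous_Re_Im (E : topologicalType) (a : E -> C) :
  continuous a -> continuous (re \o a) /\ continuous (im \o a).
Proof. by move=> ca; split=> x; have /cvg_Re_Im[] := ca x. Qed.

Context {E : normedModType R}.
Implicit Types (a b c : E -> C) (u v X : E).

Lemma complex_is_deriveD_dir a b c u v :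
  (forall X, is_derive X u a (b X)) -> (forall X, is_derive X v a (c X)) ->
  continuous c -> forall X, is_derive X (u + v) a (b X + c X).
Proof.
move=> ab ac /continuous_Re_Im[cr ci] X.
apply/is_derive_Re_Im; rewrite !raddfD; split.
- by apply: (is_deriveD_dir (re \o a) (re \o b) (re \o c)) => // Y;
    [have /is_derive_Re_Im[] := ab Y|have /is_derive_Re_Im[] := ac Y].
- by apply: (is_deriveD_dir (im \o a) (im \o b) (im \o c)) => // Y;
    [have /is_derive_Re_Im[] := ab Y|have /is_derive_Re_Im[] := ac Y].
Qed.

Lemma complex_is_deriveZ_dir a b v (t : R) :
  (forall X, is_derive X v a (b X)) -> continuous b ->
  forall X, is_derive X (t *: v) a (t *: b X).
Proof.
move=> ab /continuous_Re_Im[cr ci] X.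
apply/is_derive_Re_Im; rewrite !linearZ; split.
- by apply: (is_deriveZ_dir (re \o a) (re \o b)) => // Y;
    have /is_derive_Re_Im[] := ab Y.
- by apply: (is_deriveZ_dir (im \o a) (im \o b)) => // Y;
    have /is_derive_Re_Im[] := ab Y.
Qed.

Lemma complex_mixed_derivatives_eq a au av auv avu u v :
  (forall X, is_derive X u a (au X)) -> (forall X, is_derive X v a (av X)) ->
  (forall X, is_derive X v au (auv X)) -> (forall X, is_derive X u av (avu X)) ->
  continuous auv -> continuous avu -> auv = avu.
Proof.
move=> hu hv huv hvu /continuous_Re_Im[cr ci] /continuous_Re_Im[cr' ci'].
have er : re \o auv = re \o avu.
  by apply: (mixed_derivatives_eq (re \o a) (re \o au) (re \o av) _ _ u v) => // Y;
  [have /is_derive_Re_Im[] := hu Y|have /is_derive_Re_Im[] := hv Y|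
   have /is_derive_Re_Im[] := huv Y|have /is_derive_Re_Im[] := hvu Y].
have ei : im \o auv = im \o avu.
  by apply: (mixed_derivatives_eq (im \o a) (im \o au) (im \o av) _ _ u v) => // Y;
  [have /is_derive_Re_Im[] := hu Y|have /is_derive_Re_Im[] := hv Y|
   have /is_derive_Re_Im[] := huv Y|have /is_derive_Re_Im[] := hvu Y].
apply/funext => X; move: (congr1 (@^~ X) er) (congr1 (@^~ X) ei) => /=.
by case: (auv X) (avu X) => [? ?] [? ?] /= -> ->.
Qed.
End ComplexValued.

(** * Derivatives of smooth functions on phase space *)

Section SmoothSymbols.
Context {R : realType} {n : nat}.
Local Notation V := (phase_space R n).
Local Notation C := (Rcomplex R).
Local Notation I := ('I_n + 'I_n)%type.
Implicit Types (a b : V -> C) (s t : seq I) (X v : V).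

(** Derivative along a word in the 2n coordinate directions; the last letter is
    differentiated first. *)
Definition partial (s : seq I) a : V -> C := iter_derive (map dir s) a.

Definition coord v (i : I) : R :=
  match i with inl i => v.1 0 i | inr i => v.2 0 i end.

Lemma coord_decomposition v : v = \sum_i coord v i *: dir i.
Proof.
rewrite big_sumType /=.
have e1 : \sum_(i < n) v.1 0 i *: dir_x i = (v.1, 0) :> V.
  rewrite [v.1 in RHS]row_sum_delta.
  elim/big_rec2 : _ => // i y1 y2 _ ->.
  by rewrite /dir_x; congr pair => /=; rewrite ?scaler0 ?addr0.
have e2 : \sum_(i < n) v.2 0 i *: dir_xi i = (0, v.2) :> V.
  rewrite [v.2 in RHS]row_sum_delta.
  elim/big_rec2 : _ => // i y1 y2 _ ->.
  by rewrite /dir_xi; congr pair => /=; rewrite ?scaler0 ?addr0.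
by rewrite e1 e2; case: v {e1 e2} => x y; congr pair; rewrite /= ?addr0 ?add0r.
Qed.

Lemma partial_rcons s i a : partial (rcons s i) a = partial s ('D_(dir i) a).
Proof. by rewrite /partial /iter_derive map_rcons foldr_rcons. Qed.

Lemma smooth_partial_is_derive a : smooth a -> forall s i X,
  is_derive X (dir i) (partial s a) (partial (i :: s) a X).
Proof. by move=> sa s i X; apply: derivableP; have [] := sa s. Qed.

Lemma smooth_partial_continuous a s : smooth a -> continuous (partial s a).
Proof. by move=> /(_ s)[]. Qed.

Lemma smooth_derive a i : smooth a -> smooth ('D_(dir i) a).
Proof. by move=> sa s; have := sa (rcons s i); rewrite -/(partial _ _) partial_rcons. Qed.

Lemma is_derive_lincomb (J : Type) (r : seq J) (c : J -> R) (f : J -> V -> C)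
    (d : J -> C) X v :
  (forall j, is_derive X v (f j) (d j)) ->
  is_derive X v (fun Y => \sum_(j <- r) c j *: f j Y) (\sum_(j <- r) c j *: d j).
Proof.
move=> fd; elim: r => [|j r IH].
  rewrite big_nil; under eq_fun do rewrite big_nil; exact: is_derive_cst.
rewrite big_cons; under eq_fun do rewrite big_cons.
exact: (is_deriveD (is_deriveZ (c j) (fd j)) IH).
Qed.

Lemma continuous_lincomb (J : Type) (r : seq J) (c : J -> R) (f : J -> V -> C) :
  (forall j, continuous (f j)) -> continuous (fun Y => \sum_(j <- r) c j *: f j Y).
Proof.
move=> fc; elim: r => [|j r IH] X.
  under eq_fun do rewrite big_nil; exact: cvg_cst.
under eq_fun do rewrite big_cons.
by apply: cvgD; [apply: cvgZr; exact: fc|exact: IH].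
Qed.

Lemma partial_lincomb (J : Type) (r : seq J) (c : J -> R) (f : J -> V -> C) s :
  (forall j, smooth (f j)) ->
  partial s (fun Y => \sum_(j <- r) c j *: f j Y) =
  (fun Y => \sum_(j <- r) c j *: partial s (f j) Y).
Proof.
move=> sf; elim: s => [//|i s IH].
apply/funext => X; rewrite {1}/partial /= -/(iter_derive _ _) -/(partial _ _) IH.
by apply/derive_val/is_derive_lincomb => j; exact: smooth_partial_is_derive.
Qed.

Lemma smooth_lincomb (J : Type) (r : seq J) (c : J -> R) (f : J -> V -> C) :
  (forall j, smooth (f j)) -> smooth (fun Y => \sum_(j <- r) c j *: f j Y).
Proof.
move=> sf s; rewrite -/(partial _ _) partial_lincomb //; split.
  by apply: continuous_lincomb => j; exact: smooth_partial_continuous.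
move=> i X.
by have [] := is_derive_lincomb J r c _ _ X (dir i)
  (fun j => smooth_partial_is_derive _ (sf j) s i X).
Qed.

(** Linearity in the direction, one coordinate vector at a time; the partial
    derivatives are continuous, as [complex_is_deriveD_dir] demands. *)
Lemma smooth_directional_derivative a v : smooth a ->
  'D_v a = (fun X => \sum_i coord v i *: 'D_(dir i) a X).
Proof.
move=> sa; apply/funext => X; apply: derive_val.
rewrite [v in is_derive _ v]coord_decomposition.
elim: (index_enum _) X => [|i r IH] X.
  rewrite !big_nil; exact: is_derive0.
rewrite !big_cons.
apply: (complex_is_deriveD_dir a (fun X => coord v i *: 'D_(dir i) a X)
  (fun X => \sum_(j <- r) coord v j *: 'D_(dir j) a X)) => //.
- apply: complex_is_deriveZ_dir => [Y|].
    exact: (smooth_partial_is_derive a sa [::]).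
  exact: (smooth_partial_continuous a [:: i]).
- by apply: continuous_lincomb => j; exact: (smooth_partial_continuous a [:: j]).
Qed.

(** Multilinearity in quantitative form, at a fixed point X.  The induction
    removes the innermost direction v: the derivative of [a] along v is again
    smooth, and it satisfies the hypothesis on words one letter shorter with B
    replaced by B * \sum_i |v_i| w_i.  This is why [a] and B are quantified
    inside the induction, and it makes the expansion over all words
    unnecessary. *)
Lemma iter_derive_bound a X (w : I -> R) (B : R) (T : seq V) :
  smooth a ->
  (forall s, size s = size T -> `|partial s a X| <= B * \prod_(i <- s) w i) ->
  `|iter_derive T a X| <=
    B * \prod_(v <- T) \sum_i `|coord v i| * w i.
Proof.
elim/last_ind : T a B => [|T v IH] a B sa bound.
  by have := bound [::] erefl; rewrite !big_nil.
have -> : iter_derive (rcons T v) a = iter_derive T ('D_v a).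
  by rewrite /iter_derive foldr_rcons.
rewrite smooth_directional_derivative // -cats1 big_cat big_seq1 /=.
rewrite [X in B * X]mulrC mulrA; apply: IH.
  by apply: smooth_lincomb => i; exact: smooth_derive.
move=> s sT; rewrite partial_lincomb; last by move=> i; exact: smooth_derive.
rewrite mulr_sumr mulr_suml; apply: (le_trans (ler_norm_sum _ _ _)).
apply: ler_sum => i _; rewrite normrZ -partial_rcons.
have := bound (rcons s i); rewrite !size_rcons sT => /(_ erefl).
rewrite -cats1 big_cat big_seq1 /= => H.
apply: (le_trans (ler_wpM2l (normr_ge0 _) H)).
by rewrite le_eqVlt; apply/orP; left; apply/eqP; ring.
Qed.

Lemma partial_swap a s i j : smooth a ->
  partial (i :: j :: s) a = partial (j :: i :: s) a.
Proof.
move=> sa; apply: (complex_mixed_derivatives_eq (partial s a)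
  (partial (j :: s) a) (partial (i :: s) a) _ _ (dir j) (dir i)).
all: try by move=> X; exact: smooth_partial_is_derive.
all: exact: smooth_partial_continuous.
Qed.

Lemma partial_move a s t i : smooth a ->
  partial (s ++ i :: t) a = partial (i :: s ++ t) a.
Proof.
move=> sa; elim: s => //= j s IH.
by rewrite partial_swap // /partial /= -!/(iter_derive _ _) -!/(partial _ _) IH.
Qed.

Lemma partial_perm a s t : smooth a -> perm_eq s t -> partial s a = partial t a.
Proof.
move=> sa; elim: s t => [|i s IH] t pst.
  by have /perm_nilP -> : perm_eq t [::] by rewrite perm_sym.
have it : i \in t by rewrite -(perm_mem pst) mem_head.
case/splitPr: it pst => t1 t2.
rewrite perm_sym -cat1s perm_catCA /= perm_cons perm_sym => /IH e.
by rewrite partial_move // /partial /= -!/(iter_derive _ _) -!/(partial _ _) e.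
Qed.

(** The word read off a pair of multi-indices: x-letters, then xi-letters. *)
Definition sorted_word (beta alpha : {ffun 'I_n -> nat}) : seq I :=
  flatten [seq nseq (beta i) (inl i) | i <- enum 'I_n] ++
  flatten [seq nseq (alpha i) (inr i) | i <- enum 'I_n].

Lemma partial_sorted_word beta alpha a :
  partial_x_xi beta alpha a = partial (sorted_word beta alpha) a.
Proof.
rewrite /partial_x_xi /mi_dirs /partial /sorted_word map_cat !map_flatten -!map_comp.
by congr (iter_derive (flatten _ ++ flatten _) _); apply: eq_map => i /=;
  rewrite map_nseq.
Qed.

Lemma count_flatten_nseq (f : 'I_n -> nat) (e : 'I_n -> I) (x : I) :
  count_mem x (flatten [seq nseq (f i) (e i) | i <- enum 'I_n]) =
  (\sum_i (e i == x) * f i)%N.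
Proof.
rewrite count_flatten sumnE big_map big_map big_enum /=.
by apply: eq_bigr => i _; rewrite count_nseq.
Qed.

(** Every word is, up to the order of its letters, the word of a pair of
    multi-indices; this is how the symmetry of partial derivatives gets used. *)
Lemma perm_sorted_word s :
  perm_eq s (sorted_word [ffun i => count_mem (inl i) s]
                        [ffun i => count_mem (inr i) s]).
Proof.
rewrite /perm_eq; apply/allP => x _; rewrite /= /sorted_word count_cat !count_flatten_nseq.
apply/eqP; case: x => x.
- rewrite (bigD1 x) //= eqxx mul1n ffunE big1 ?big1 ?addn0 // => i ix.
  by rewrite -[inl i == inl x]/(i == x) (negbTE ix).
- rewrite addnC (bigD1 x) //= eqxx mul1n ffunE big1 ?big1 ?addn0 // => i ix.
  by rewrite -[inr i == inr x]/(i == x) (negbTE ix).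
Qed.

Lemma prod_sorted_word beta alpha (p q : R) :
  \prod_(i <- sorted_word beta alpha) (if i is inl _ then p else q) =
  p ^+ mi_order beta * q ^+ mi_order alpha.
Proof.
rewrite /sorted_word big_cat !big_flatten big_map big_enum big_map big_enum /= /mi_order !expr_sum.
by congr (_ * _); apply: eq_bigr => i _; rewrite big_nseq iter_mulr_1.
Qed.

End SmoothSymbols.

(** * Comparison of the weights *)

Section Weights.
Context {R : realType}.

Lemma ler_powR_base (q a b : R) : 0 <= q -> 0 <= a -> a <= b -> a `^ q <= b `^ q.
Proof.
by move=> q0 a0 ab; apply: (@ge0_ler_powR R q q0); rewrite ?nnegrE //; lra.
Qed.

(** The hypotheses are symmetric in a and b so that a negative exponent, which
    exchanges them, is covered too. *)
Lemma powR_comparable (c a b q : R) : 0 <= c -> 0 < a -> 0 < b ->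
  a <= c * b -> b <= c * a -> a `^ q <= c `^ `|q| * b `^ q.
Proof.
move=> c0 a0 b0 ab ba.
have [q0|q0] := leP 0 q.
  by rewrite (ger0_norm q0) -powRM ?ler_powR_base // ltW.
have q'0 : 0 <= - q by rewrite oppr_ge0 ltW.
rewrite ltr0_norm //.
have e (x : R) : x `^ q = (x `^ (- q))^-1 by rewrite -powRN opprK.
rewrite !e ler_pdivlMr ?powR_gt0 // mulrC ler_pdivrMr ?powR_gt0 //.
by rewrite -powRM ?ler_powR_base // ltW.
Qed.

Context {n : nat}.
Local Notation V := (phase_space R n).
Local Notation I := ('I_n + 'I_n)%type.
Implicit Types (X v : V).

Lemma euclidean_norm_ge0 (x : 'rV[R]_n) : 0 <= euclidean_norm x.
Proof. exact: sqrtr_ge0. Qed.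

Lemma coord_le_euclidean_norm (x : 'rV[R]_n) i : `|x 0 i| <= euclidean_norm x.
Proof.
rewrite /euclidean_norm -sqrtr_sqr ler_sqrt ?sumr_ge0 // => [|j _]; last exact: sqr_ge0.
by rewrite (bigD1 i) //= lerDl sumr_ge0 // => j _; rewrite sqr_ge0.
Qed.

Lemma euclidean_norm_delta (i : 'I_n) : euclidean_norm (delta_mx 0 i : 'rV[R]_n) = 1.
Proof.
rewrite /euclidean_norm (bigD1 i) //= big1 => [|j ji]; rewrite mxE eqxx ?eqxx /=.
  by rewrite expr1n addr0 sqrtr1.
by rewrite (negbTE ji) expr0n.
Qed.

Lemma euclidean_norm0 : euclidean_norm (0 : 'rV[R]_n) = 0.
Proof.
rewrite /euclidean_norm big1 ?sqrtr0 // => j _.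
by rewrite mxE expr0n.
Qed.

Variables k l : nat.
Hypotheses (k_gt0 : (0 < k)%N) (l_gt0 : (0 < l)%N).

Local Notation W := (weight k l).

Lemma weight_gt0 X : 0 < weight k l X.
Proof.
by rewrite /weight -addrA ltr_pwDl ?addr_ge0 ?exprn_ge0 ?euclidean_norm_ge0.
Qed.

(** With p = |x|^k and q = |xi|^l this says that
    1 + p^2 + q^2 <= (1 + p + q)^2 <= 3 (1 + p^2 + q^2). *)
Lemma weight_comparable X
  (Q := 1 + euclidean_norm X.1 ^+ k + euclidean_norm X.2 ^+ l) :
  weight k l X <= Q ^+ 2 <= 3 * weight k l X.
Proof.
rewrite /Q /weight ![(2 * _)%N]mulnC !exprM.
have := exprn_ge0 k (euclidean_norm_ge0 X.1).
have := exprn_ge0 l (euclidean_norm_ge0 X.2).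
set p := _ ^+ k; set q := _ ^+ l => q0 p0; apply/andP; split.
  have := mulr_ge0 p0 q0; nra.
have := sqr_ge0 (p - q); have := sqr_ge0 (p - 1); have := sqr_ge0 (q - 1); nra.
Qed.

(** g_X(e)^(1/2) for the coordinate vector e in direction i, that is, the gain
    in W for each derivative in that direction (see [sqrt_metric_dir]). *)
Definition dual_length X (i : I) : R :=
  match i with inl _ => W X `^ (- (2 * k%:R)^-1) | inr _ => W X `^ (- (2 * l%:R)^-1) end.

Lemma dual_length_ge0 X i : 0 <= dual_length X i.
Proof. by case: i => i; exact: powR_ge0. Qed.

Lemma dual_lengthE (p : nat) X (r : R) : (0 < p)%N -> 0 <= r ->
  r * W X `^ (- (2 * p%:R)^-1) = Num.sqrt (r ^+ 2 / W X `^ p%:R^-1).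
Proof.
move=> p0 r0; have pp : 0 < p%:R :> R by rewrite ltr0n.
rewrite -powRN sqrtrM ?sqr_ge0 // sqrtr_sqr ger0_norm //; congr (_ * _).
rewrite -powR12_sqrt ?powR_ge0 // -powRrM; congr (_ `^ _).
by field; rewrite gt_eqF.
Qed.

Lemma coord_dual_length_le X v i :
  `|coord v i| * dual_length X i <= Num.sqrt (metric k l X v).
Proof.
have hx : 0 <= euclidean_norm v.1 ^+ 2 / weight k l X `^ (k%:R^-1).
  by rewrite divr_ge0 ?powR_ge0 ?sqr_ge0.
have hxi : 0 <= euclidean_norm v.2 ^+ 2 / weight k l X `^ (l%:R^-1).
  by rewrite divr_ge0 ?powR_ge0 ?sqr_ge0.
case: i => i /=.
- apply: (le_trans (ler_wpM2r (powR_ge0 _ _) (coord_le_euclidean_norm v.1 i))).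
  by rewrite dual_lengthE ?euclidean_norm_ge0 // ler_sqrt /metric ?addr_ge0 // lerDl.
- apply: (le_trans (ler_wpM2r (powR_ge0 _ _) (coord_le_euclidean_norm v.2 i))).
  by rewrite dual_lengthE ?euclidean_norm_ge0 // ler_sqrt /metric ?addr_ge0 // lerDr.
Qed.

Lemma sqrt_metric_dir X i : Num.sqrt (metric k l X (dir i)) = dual_length X i.
Proof.
rewrite /metric; case: i => i /=; rewrite euclidean_norm_delta euclidean_norm0.
- by rewrite expr0n mul0r addr0 -dual_lengthE // mul1r.
- by rewrite expr0n mul0r add0r -dual_lengthE // mul1r.
Qed.

Lemma uncertainty_powE (m : R) X :
  uncertainty k l X `^ (m * ((k * l)%:R / (k + l)%:R)) = weight k l X `^ (m / 2).
Proof.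
rewrite /uncertainty -powRrM; congr (_ `^ _).
have k0 : k%:R != 0 :> R by rewrite pnatr_eq0 -lt0n.
have l0 : l%:R != 0 :> R by rewrite pnatr_eq0 -lt0n.
have kl0 : k%:R + l%:R != 0 :> R by rewrite -natrD pnatr_eq0 -lt0n addn_gt0 k_gt0.
by rewrite !natrM natrD; field; rewrite k0 l0 kl0.
Qed.

Lemma order_weightE (m : R) (beta alpha : {ffun 'I_n -> nat}) X :
  W X `^ (m / 2) * \prod_(i <- sorted_word beta alpha) dual_length X i =
  W X `^ ((m - (mi_order beta)%:R / k%:R - (mi_order alpha)%:R / l%:R) / 2).
Proof.
have k0 : k%:R != 0 :> R by rewrite pnatr_eq0 -lt0n.
have l0 : l%:R != 0 :> R by rewrite pnatr_eq0 -lt0n.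
have W0 : W X != 0 by rewrite gt_eqF ?weight_gt0.
rewrite (eq_bigr (fun i : I => if i is inl _ then W X `^ (- (2 * k%:R)^-1)
   else W X `^ (- (2 * l%:R)^-1))); last by case.
rewrite prod_sorted_word -!powR_mulrn ?powR_ge0 // -!powRrM -!powRD ?W0 ?implybT //.
by congr (_ `^ _); field; rewrite k0 l0.
Qed.

End Weights.

(** * Both classes are described by bounds on coordinate derivatives *)

Section Classes.
Context {R : realType} {n : nat}.
Local Notation V := (phase_space R n).
Local Notation C := (Rcomplex R).
Local Notation I := ('I_n + 'I_n)%type.
Variables (m : R) (k l : nat).
Hypotheses (k_gt0 : (0 < k)%N) (l_gt0 : (0 < l)%N).

Definition coordinate_bounds (a : V -> C) : Prop :=
  forall s : seq I, exists2 c : R, 0 < c & forall X : V,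
    `|partial s a X| <=
      c * (weight k l X `^ (m / 2) * \prod_(i <- s) dual_length k l X i).

Lemma weight_powR_comparable (p : R) (X : V)
  (Q := 1 + euclidean_norm X.1 ^+ k + euclidean_norm X.2 ^+ l) :
  Q `^ p <= 3 `^ `|p / 2| * weight k l X `^ (p / 2) /\
  weight k l X `^ (p / 2) <= 3 `^ `|p / 2| * Q `^ p.
Proof.
have /andP[lo hi] := weight_comparable k l X; rewrite -/Q in lo hi.
have W0 : 0 < weight k l X := weight_gt0 k l X.
have Q0 : 0 <= Q by rewrite /Q !addr_ge0 // exprn_ge0 // euclidean_norm_ge0.
have -> : Q `^ p = (Q ^+ 2) `^ (p / 2).
  by rewrite -powR_mulrn // -powRrM; congr (_ `^ _); field.
by split; apply: powR_comparable => //; lra.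
Qed.

(** Sorting the letters of a word turns it into a pair of multi-indices, whose
    orders determine the exponent of Q in the bound. *)
Lemma Sigma_classE : Sigma_class m k l = [set a : V -> C | smooth a /\ coordinate_bounds a].
Proof.
apply/seteqP; split=> a [sa bound]; split=> //.
- move=> s.
  pose beta := [ffun i => count_mem (inl i) s].
  pose alpha := [ffun i => count_mem (inr i) s].
  have [c c0 ac] := bound alpha beta.
  set p := m - _ - _ in ac.
  exists (c * 3 `^ `|p / 2|) => [|X]; first by rewrite mulr_gt0 // powR_gt0.
  rewrite (partial_perm a s _ sa (perm_sorted_word s)) (perm_big _ (perm_sorted_word s)) /=.
  rewrite order_weightE // -partial_sorted_word.
  have := ac X.1 X.2; rewrite -surjective_pairing => /le_trans; apply.
  rewrite -mulrA ler_pM2l //.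
  by have [] := weight_powR_comparable p X.
- move=> alpha beta.
  have [c c0 ac] := bound (sorted_word beta alpha).
  set p := m - _ - _.
  exists (c * 3 `^ `|p / 2|) => [|x xi]; first by rewrite mulr_gt0 // powR_gt0.
  have := ac (x, xi); rewrite order_weightE // -partial_sorted_word => /le_trans; apply.
  rewrite -mulrA ler_pM2l //.
  by have [] := weight_powR_comparable p (x, xi).
Qed.

(** In one direction the directions are specialized to coordinate vectors.  In
    the other, the sum of the constants of the finitely many words of length j
    serves for all of them, and each direction costs a factor of at most 2n,
    the number of coordinates. *)
Lemma S_classE :
  S_class (fun X : V => uncertainty k l X `^ (m * ((k * l)%:R / (k + l)%:R)))
    (metric k l) = [set a : V -> C | smooth a /\ coordinate_bounds a].
Proof.
apply/seteqP; split=> a [sa bound]; split=> //.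
- move=> s; have [c c0 ac] := bound (size s).
  exists c => // X.
  have := ac X [tuple of map dir (in_tuple s)].
  rewrite uncertainty_powE // -(big_tuple _ _ _ xpredT (fun v => Num.sqrt (metric k l X v))).
  rewrite /= big_map mulrA.
  by under eq_bigr do rewrite sqrt_metric_dir //.
- move=> j.
  have /choice[c cP] : forall s : j.-tuple I, exists c : R, 0 < c /\ forall X : V,
      `|partial s a X| <=
        c * (weight k l X `^ (m / 2) * \prod_(i <- s) dual_length k l X i).
    by move=> s; have [c c0 ac] := bound s; exists c.
  (* The terms 1 here, and in (n + n).+1 below, only ensure positivity. *)
  pose c_tot := 1 + \sum_s c s.
  have c_ge0 s : 0 <= c s by apply: ltW; have [] := cP s.
  have c_tot0 : 0 < c_tot by rewrite ltr_pwDl // sumr_ge0.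
  exists (c_tot * (n + n).+1%:R ^+ j) => [|X T].
    by rewrite mulr_gt0 // exprn_gt0.
  rewrite uncertainty_powE // -(big_tuple _ _ _ xpredT (fun v => Num.sqrt (metric k l X v))) /=.
  have W0 : 0 <= weight k l X `^ (m / 2) by exact: powR_ge0.
  have L0 := dual_length_ge0 k l X.
  apply: (le_trans (iter_derive_bound a X (dual_length k l X)
    (c_tot * weight k l X `^ (m / 2)) T sa _)).
    move=> s; rewrite size_tuple => /eqP sj.
    have [_ /(_ X)] := cP (Tuple sj); rewrite /= => /le_trans; apply.
    rewrite mulrA ler_wpM2r ?prodr_ge0 // ler_wpM2r //.
    by rewrite /c_tot (bigD1 (Tuple sj)) //= addrCA lerDl addr_ge0 // sumr_ge0.
  rewrite [c_tot * _ ^+ _ * _]mulrAC -[leRHS]mulrA ler_wpM2l ?mulr_ge0 ?(ltW c_tot0) //.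
  have -> : (n + n).+1%:R ^+ j = \prod_(v <- T) (n + n).+1%:R :> R.
    by rewrite big_tuple prodr_const card_ord.
  rewrite -big_split /=; apply: ler_prod => v _.
  rewrite sumr_ge0 => [/=|i _]; last by rewrite mulr_ge0.
  apply: (@le_trans _ _ (\sum_(i : I) Num.sqrt (metric k l X v))).
    by apply: ler_sum => i _; exact: coord_dual_length_le.
  rewrite sumr_const card_sum card_ord -[leLHS]mulr_natl ler_wpM2r ?sqrtr_ge0 //.
  by rewrite ler_nat.
Qed.

End Classes.

Theorem proposition4p2 (R : realType) (n : nat) (m : R) (k l : nat)
    (n_ge1 : (1 <= n)%N) (k_ge1 : (1 <= k)%N) (l_ge1 : (1 <= l)%N) :
  Sigma_class m k l =
  S_class
    (fun X : phase_space R n =>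
       uncertainty k l X `^ (m * ((k * l)%:R / (k + l)%:R)))
    (metric k l).
Proof. by rewrite Sigma_classE // S_classE. Qed.
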